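(* For a perfect finite-dimensional evolution algebra $A$ over a field $\mathbb K$, being basic simple does not depend on the natural basis: if $B$ and $B'$ are natural bases of $A$, then $A$ has no nonzero proper basic ideals relative to $B$ if and only if $A$ has no nonzero proper basic ideals relative to $B'$.
   Context: An evolution algebra over a field $\mathbb K$ is a (not necessarily associative) $\mathbb K$-algebra $A$ having a basis $B=\{e_j \mid j\in\Lambda\}$ with $e_je_k=0$ whenever $j\neq k$; such a basis is called a natural basis. $A$ is perfect if $A^2=A$, where $A^2$ is the linear span of all products. A nonzero proper ideal $I$ of $A$ is a basic ideal relative to the natural basis $B$ if $I$ is the linear span of a subset of $B$. $A$ is called basic simple if it has no nonzero proper basic ideals. *)

(* Defs.v *)
From mathcomp Require Import all_boot all_order all_algebra.

Set Implicit Arguments.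
Unset Strict Implicit.
Unset Printing Implicit Defensive.

Import GRing.Theory.
Local Open Scope ring_scope.

(* A finite-dimensional, not necessarily associative K-algebra is a [vectType K]
   together with a bilinear product [mul]; neither associativity, nor
   commutativity, nor a unit is assumed. *)
Section EvolutionAlgebra.

Variables (K : fieldType) (A : vectType K) (mul : {bilinear A -> A -> A}).

(* [basis_of] makes the sequence [B] free, hence duplicate-free, so distinct
   indices of the basis are the same thing as distinct elements of [B]. *)
Definition natural_basis (B : seq A) : Prop :=
  basis_of fullv B /\ {in B &, forall x y : A, x != y -> mul x y = 0}.

Definition evolution_algebra : Prop := exists B : seq A, natural_basis B.

(* A^2 = A. There are infinitely many products in general, and [span] takes a
   finite sequence: a vector is in the linear span A^2 of all the products when
   it is in the span of finitely many of them. *)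
Definition perfect : Prop :=
  forall a : A, exists s : seq (A * A), a \in <<[seq mul p.1 p.2 | p <- s]>>%VS.

Definition ideal (I : {vspace A}) : Prop :=
  forall a x : A, x \in I -> mul a x \in I /\ mul x a \in I.

Definition basic_ideal (B : seq A) (I : {vspace A}) : Prop :=
  [/\ ideal I, I != 0%VS, I != fullv
    & exists2 S : seq A, {subset S <= B} & I = <<S>>%VS].

Definition basic_simple (B : seq A) : Prop :=
  ~ exists I : {vspace A}, basic_ideal B I.

End EvolutionAlgebra.

(* Main.v *)
Require Import Defs.
From mathcomp Require Import all_boot all_order all_algebra.

(** In a natural basis [B] the product is diagonal,
    a b = \sum_i a_i b_i e_i^2, so A^2 is spanned by the squares e_i^2; when A
    is perfect there are as many of them as the dimension, hence they form a
    basis ([free_squares]).  Now let f belong to another natural basis [B'].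
    Reading f e_i in [B] gives f_i e_i^2, while reading it in [B'] gives a
    multiple of f^2.  All the vectors f_i e_i^2 thus lie on one line, and since
    the squares e_i^2 are independent, f has a single nonzero coordinate: f is a
    scalar multiple of an element of [B] ([natural_basis_line]).  In other words
    the natural basis of a perfect evolution algebra is unique up to scaling and
    permutation, so two natural bases span the same subspaces with their
    subsets, and the basic ideals relative to [B] and to [B'] coincide. *)

Set Implicit Arguments.
Unset Strict Implicit.
Unset Printing Implicit Defensive.

Import GRing.Theory.
Local Open Scope ring_scope.

Section NaturalBases.

Variables (K : fieldType) (A : vectType K) (mul : {bilinear A -> A -> A}).

Lemma natural_mulE (B : seq A) (a b : A) : natural_basis mul B ->
  let e := in_tuple B in
  mul a b = \sum_i (coord e i a * coord e i b) *: mul e`_i e`_i.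
Proof.
case=> basB orthB e.
rewrite {1}(coord_basis (X := e) basB (memvf a)) linear_sumlz.
apply: eq_bigr => i _; rewrite linearZl_LR /=.
rewrite {1}(coord_basis (X := e) basB (memvf b)) linear_sumr.
rewrite (bigD1 i) //= big1 => [|j neq_ji].
  by rewrite addr0 linearZr_LR scalerA.
rewrite linearZr_LR /= orthB ?scaler0 ?mem_nth //.
by rewrite nth_uniq ?(free_uniq (basis_free basB)) // eq_sym.
Qed.

Lemma natural_mulr_nth (B : seq A) (a : A) (i : 'I_(size B)) :
  natural_basis mul B ->
  mul a B`_i = coord (in_tuple B) i a *: mul B`_i B`_i.
Proof.
move=> natB; have [basB _] := natB.
have coordE j : coord (in_tuple B) j B`_i = (i == j)%:R.
  exact: (coord_free (X := in_tuple B) i j (basis_free basB)).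
rewrite (natural_mulE a B`_i natB) (bigD1 i) //= big1 => [|j neq_ji].
  by rewrite addr0 coordE eqxx mulr1.
by rewrite coordE eq_sym (negbTE neq_ji) mulr0 scale0r.
Qed.

Lemma natural_mulC (B : seq A) (a b : A) : natural_basis mul B ->
  mul a b = mul b a.
Proof.
move=> natB; rewrite !(natural_mulE _ _ natB).
by apply: eq_bigr => i _; rewrite [coord _ i a * _]mulrC.
Qed.

(** The squares of a natural basis span A^2, so in a perfect algebra they are a
    spanning family whose size is the dimension. *)
Lemma free_squares (B : seq A) : natural_basis mul B -> perfect mul ->
  free [seq mul x x | x <- B].
Proof.
move=> natB perf; have [basB _] := natB.
apply: (@basis_free _ _ fullv); rewrite basisEdim size_map (size_basis (X := in_tuple B) basB).
rewrite leqnn andbT; apply/subvP => a _; have [s] := perf a.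
apply: subvP; apply/span_subvP => _ /mapP[p _ ->].
rewrite (natural_mulE _ _ natB); apply: memv_suml => i _.
by apply/memvZ/memv_span/map_f/mem_nth.
Qed.

Lemma natural_basis_line (B B' : seq A) (f : A) :
  natural_basis mul B -> natural_basis mul B' -> perfect mul -> f \in B' ->
  exists2 x, x \in B & exists2 c, c != 0 & f = c *: x.
Proof.
move=> natB natB' perf fB'; have [[basB _] [basB' _]] := (natB, natB').
pose e := in_tuple B; pose sq := [tuple of [seq mul x x | x <- e]].
have free_sq : free sq := free_squares natB perf.
have sqE (i : 'I_(size B)) : sq`_i = mul B`_i B`_i.
  by rewrite (nth_map 0).
(* Both bases compute the product of f with the i-th element of B. *)
have line i : exists d, coord e i f *: sq`_i = d *: mul f f.
  have /(nthP 0)[k ltk <-] := fB'.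
  exists (coord (in_tuple B') (Ordinal ltk) B`_i).
  rewrite sqE -(natural_mulr_nth _ _ natB) (natural_mulC _ _ natB).
  exact: (natural_mulr_nth B`_i (Ordinal ltk) natB').
have fE : f = \sum_i coord e i f *: B`_i := coord_basis (X := e) basB (memvf f).
have [i ci0 | c0] := pickP (fun i => coord e i f != 0); last first.
  have := free_not0 (basis_free basB') fB'.
  by rewrite fE big1 ?eqxx // => i _; rewrite (eqP (negbFE (c0 i))) scale0r.
exists B`_i; first exact: mem_nth.
exists (coord e i f) => //.
rewrite {1}fE (bigD1 i) //= big1 ?addr0 // => j neq_ji.
have [[di Ei] [dj Ej]] := (line i, line j).
have di0 : di != 0.
  apply: contra_neq ci0 => di0; move: Ei; rewrite di0 scale0r.
  by move/(congr1 (coord sq i)); rewrite linearZ /= coord_free // eqxx mulr1 linear0.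
(* Eliminating f^2 leaves a relation between the squares numbered i and j. *)
have : di *: (coord e j f *: sq`_j) = dj *: (coord e i f *: sq`_i).
  by rewrite Ei Ej !scalerA mulrC.
move/(congr1 (coord sq j)); rewrite !linearZ /= !coord_free // eqxx.
rewrite eq_sym (negbTE neq_ji) mulr1 !mulr0 => /eqP.
by rewrite mulf_eq0 (negbTE di0) => /eqP->; rewrite scale0r.
Qed.

Lemma basic_ideal_transfer (B B' : seq A) (I : {vspace A}) :
  natural_basis mul B -> natural_basis mul B' -> perfect mul ->
  basic_ideal mul B' I -> basic_ideal mul B I.
Proof.
move=> natB natB' perf [idI I0 IT [S sSB' IS]]; split=> //.
(* Each f in S is a nonzero multiple of some x in B, and then x lies in I too. *)
exists [seq x <- B | x \in I]; first by move=> x; rewrite mem_filter => /andP[].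
apply/eqP; rewrite eqEsubv; apply/andP; split; last first.
  by apply/span_subvP => x; rewrite mem_filter => /andP[].
rewrite {1}IS; apply/span_subvP => f fS.
have fI : f \in I by rewrite IS memv_span.
have [x xB [c c0 fE]] := natural_basis_line natB natB' perf (sSB' f fS).
rewrite fE; apply/memvZ/memv_span; rewrite mem_filter xB andbT.
by rewrite -[x](scalerK c0) -fE memvZ.
Qed.

End NaturalBases.

Theorem corollary2p9 (K : fieldType) (A : vectType K)
    (mul : {bilinear A -> A -> A}%R)
    (hA : evolution_algebra mul) (hperf : perfect mul)
    (B B' : seq A) (hB : natural_basis mul B) (hB' : natural_basis mul B') :
  basic_simple mul B <-> basic_simple mul B'.
Proof.
by split=> simpleB [I basI]; apply: simpleB; exists I;
  apply: basic_ideal_transfer basI.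
Qed.
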